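(* Let $n,p\ge 1$ be integers and $(a_0,a_1,\ldots,a_p)\in[0,\infty)^{p+1}$. Put $P(X)=a_0+a_1X+\cdots+a_pX^p$ and $f(x)=a_0+a_1\sigma_1(x)+\cdots+a_p\sigma_p(x)$ for $x\in\mathbb{R}^n$. If there exist an integer $m\ge 0$ and a polynomial $R\in\mathbb{R}[X]$ with non-negative coefficients and degree at most $m-1$ (so $R=0$ if $m=0$) such that $X^mP+R$ is real-rooted, then $f^{1/p}$ is concave on $(0,\infty)^n$. Equivalently, when $a_p>0$: if there exist an integer $m\ge 0$ and $\lambda\in[0,\infty)^{m+p}$ such that $$\frac{a_k}{a_p}=\sigma_{p-k}(\lambda)\qquad\text{for all } 0\le k\le p,$$ then $f^{1/p}$ is concave on $(0,\infty)^n$.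
   Context: $\sigma_k$ denotes the $k$-th elementary symmetric polynomial in the coordinates of its vector argument ($\sigma_0=1$, and $\sigma_k=0$ if $k$ exceeds the number of coordinates). A real polynomial is real-rooted if all its complex roots are real. *)

(* Defs.v *)
From HB Require Import structures.
From mathcomp Require Import all_boot all_order all_algebra.
From mathcomp Require Import all_classical all_reals all_analysis.
From mathcomp Require Import complex.
From mathcomp Require mpoly.
(* The notations of mpoly are incompatible with those of mathcomp-analysis. *)
Import -(notations) mpoly.

Set Implicit Arguments.
Unset Strict Implicit.
Unset Printing Implicit Defensive.

Import Order.TTheory GRing.Theory Num.Theory.
Local Open Scope classical_set_scope.
Local Open Scope ring_scope.
Local Open Scope convex_scope.

Definition sigma (R : comNzRingType) (n k : nat) (x : 'rV[R]_n) : R :=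
  meval (x ord0) (mesym n R k).

Lemma sigmaE (R : comNzRingType) (n k : nat) (x : 'rV[R]_n) :
  sigma k x = \sum_(A : {set 'I_n} | #|A| == k) \prod_(i in A) x ord0 i.
Proof.
rewrite /sigma /mesym raddf_sum /=; apply: eq_bigr => A _.
rewrite rmorph_prod; apply: eq_bigr => i _; exact: mevalXU.
Qed.

(* The zero polynomial, of which every complex number is a root, is not
   real-rooted. *)
Definition real_rooted (R : rcfType) (p : {poly R}) : Prop :=
  forall z : R[i], root (map_poly (real_complex R) p) z -> z \is Num.real.

Lemma real_rootedE (R : rcfType) (p : {poly R}) :
  real_rooted p <->
  forall z : R[i], root (map_poly (real_complex R) p) z -> complex.Im z = 0.
Proof.
split=> rp [a b] /rp; rewrite complex_real; first by move/eqP.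
by move=> /= ->.
Qed.

(* The mirror image of convex_function. *)
Definition concave_function (R : numFieldType) (E : lmodType R)
    (E' := convex_lmodType E) (D : set E') (f : E' -> R^o) : Prop :=
  forall t : {i01 R},
    {in D &, forall x y : E', f x <| t |> f y <= f (x <| t |> y)}.

Lemma concave_functionE (R : realFieldType) (E : lmodType R) (D : set E)
    (f : E -> R) :
  concave_function D f <->
  forall (t : R) (x y : E), 0 <= t <= 1 -> D x -> D y ->
    t * f x + (1 - t) * f y <= f (t *: x + (1 - t) *: y).
Proof.
split=> [cf t x y /andP[t0 t1] Dx Dy|cf t x y].
  by apply: (cf (Itv01 t0 t1)); rewrite inE.
by rewrite !inE => Dx Dy; apply: cf => //; rewrite ge0 le1.
Qed.

(* Main.v *)
(* Write F = X^m P + Q = c prod_i (X + l_i), where l_i >= 0 because F has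
   nonnegative coefficients.  Reading off coefficients, f x is c times sigma_d of
   the concatenation of l and x, with d = deg P <= p, so it suffices that
   sigma_d^(1/p) is concave on the nonnegative orthant.  Now sigma_d is the
   product of the quotients q_k = sigma_(k+1) / sigma_k for k < d, and a
   geometric mean of concave nonnegative functions is concave by AM-GM.  Each
   q_k is concave (Marcus-Lopes) by induction on k: (k+2) q_(k+1)(x) is the sum
   over i of h(x_i, q_k(x without x_i)), where h(a, b) = a b / (a + b) is concave
   and nondecreasing. *)

Require Import Defs.
From mathcomp Require Import all_boot all_order all_algebra.
From mathcomp Require Import all_classical all_reals all_analysis.
From mathcomp Require Import complex ring.

Set Implicit Arguments.
Unset Strict Implicit.
Unset Printing Implicit Defensive.

Import Order.TTheory GRing.Theory Num.Theory.
Local Open Scope classical_set_scope.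
Local Open Scope ring_scope.

(** * Elementary symmetric polynomials through their generating polynomial *)

Section ElementarySymmetric.
Variables (R : comNzRingType) (I : finType).
Implicit Types (A : {set I}) (x : I -> R).

(** Indexing by a set [A] keeps the type of [x] fixed when a variable is deleted, which the
    inductions below rely on. *)
Definition esymp A x : {poly R} := \prod_(i in A) (1 + x i *: 'X).

Definition esym A k x : R := (esymp A x)`_k.

Lemma esymp_setD1 A x i : i \in A ->
  esymp A x = (1 + x i *: 'X) * esymp (A :\ i) x.
Proof. by move=> iA; rewrite /esymp (big_setD1 i). Qed.

Lemma esym0 A x : esym A 0 x = 1.
Proof.
rewrite /esym /esymp coef0_prod big1 // => i _.
by rewrite coefD coef1 coefZ coefX mulr0 addr0.
Qed.

Lemma esymS_setD1 A k x i : i \in A ->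
  esym A k.+1 x = esym (A :\ i) k.+1 x + x i * esym (A :\ i) k x.
Proof.
move=> iA; rewrite /esym (esymp_setD1 x iA).
by rewrite mulrDl mul1r coefD -scalerAl coefZ coefXM.
Qed.

Lemma deriv_esymp A x :
  (esymp A x)^`() = \sum_(i in A) x i *: esymp (A :\ i) x.
Proof.
have [m] := ubnP #|A|; elim: m A => // m IH A cA.
have [->|[j jA]] := set_0Vmem A; first by rewrite /esymp !big_set0 derivC.
rewrite (esymp_setD1 x jA) derivM IH; last first.
  by move: cA; rewrite (cardsD1 j) jA.
rewrite derivD derivC derivZ derivX add0r alg_polyC mul_polyC.
rewrite [RHS](big_setD1 j) //=; congr (_ + _).
rewrite mulr_sumr; apply: eq_bigr => i /setD1P[ij iA].
rewrite -scalerAr; congr (_ *: _).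
rewrite (@esymp_setD1 (A :\ i) _ j) ?inE 1?eq_sym ?ij //.
by rewrite !finset.setDDl finset.setUC.
Qed.

(** Compare the coefficients of ['X^k] in the derivative of the generating polynomial. *)
Lemma esymS_sum A k x :
  esym A k.+1 x *+ k.+1 = \sum_(i in A) x i * esym (A :\ i) k x.
Proof.
rewrite /esym -coef_deriv deriv_esymp coef_sum.
by apply: eq_bigr => i _; rewrite coefZ.
Qed.

End ElementarySymmetric.

Lemma esymp_sum (R : comNzRingType) (I J : finType) (u : I -> R) (x : J -> R) :
  esymp [set: I + J] (fun i => match i with inl i => u i | inr j => x j end) =
  esymp [set: I] u * esymp [set: J] x.
Proof.
rewrite /esymp big_sumType /=.
by congr (_ * _); apply: eq_bigl => i; rewrite !inE.
Qed.

(** Generating polynomials multiply under concatenation, so their coefficients convolve. This later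
    merges [lambda] and [x] into one vector. *)
Lemma esym_sum (R : comNzRingType) (I J : finType) k (u : I -> R) (x : J -> R) :
  esym [set: I + J] k
    (fun i => match i with inl i => u i | inr j => x j end) =
  \sum_(i < k.+1) esym [set: I] (k - i) u * esym [set: J] i x.
Proof. by rewrite /esym esymp_sum coefMr. Qed.

Lemma sigma_esym (R : comNzRingType) n k (x : 'rV[R]_n) :
  sigma k x = esym [set: 'I_n] k (x ord0).
Proof.
rewrite sigmaE /esym /esymp (eq_bigl xpredT) => [|i]; last by rewrite inE.
under [in RHS]eq_bigr do rewrite addrC.
rewrite bigA_distr coef_sum big_mkcond /=; apply: eq_bigr => A _.
rewrite -big_mkcond /= scaler_prod prodr_const coefZ coefXn eq_sym.
by case: eqP; rewrite (mulr1, mulr0).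
Qed.

(** Vieta's formulas: when the factors in a set [A] contribute their constants, the resulting term
    has degree [n - #|A|]. *)
Lemma coef_prod_XaddC (R : comNzRingType) n k (x : 'rV[R]_n) : (k <= n)%N ->
  (\prod_(i < n) ('X + (x ord0 i)%:P))`_(n - k) = sigma k x.
Proof.
move=> kn; rewrite sigmaE; under eq_bigr do rewrite addrC.
rewrite bigA_distr coef_sum big_mkcond /= [RHS]big_mkcond /=.
apply: eq_bigr => A _; rewrite (bigID (mem A)) /=.
rewrite (eq_bigr (fun i => (x ord0 i)%:P)); last by move=> i ->.
rewrite (eq_bigr (fun=> 'X) (P := fun i => i \notin A)); last first.
  by move=> i /negbTE->.
rewrite prodr_const -rmorph_prod mul_polyC coefZ coefXn /=.
have -> : #|[predC A]| = (n - #|A|)%N.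
  by rewrite -(addKn #|A| #|[predC A]|) cardC card_ord.
have An : (#|A| <= n)%N by rewrite (leq_trans (max_card _)) ?card_ord.
rewrite -(eqn_add2r (k + #|A|)) addnA subnK // addnCA subnK // addnC eqn_add2r.
by rewrite eq_sym; case: eqP; rewrite (mulr1, mulr0).
Qed.

(** * Concavity of quotients of consecutive elementary symmetric polynomials *)

Section QuotientConcavity.
Variables (R : realFieldType) (I : finType).
Implicit Types (A : {set I}) (x y : I -> R).

Lemma esym_ge0 A k x : (forall i, 0 <= x i) -> 0 <= esym A k x.
Proof.
move=> x_ge0; have [m] := ubnP #|A|; elim: m A k => // m IH A k cA.
have [->|[j jA]] := set_0Vmem A.
  by rewrite /esym /esymp big_set0 coef1; case: eqP.
case: k => [|k]; first by rewrite esym0.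
have cA' : (#|A :\ j| < m)%N by move: cA; rewrite (cardsD1 j) jA.
by rewrite (esymS_setD1 _ _ jA) addr_ge0 ?mulr_ge0 ?IH.
Qed.

(** In [esymS_sum] every summand vanishes: [esym (A :\ i) k x] is one of two non-negative terms
    whose sum is [esym A k x]. *)
Lemma esymS_eq0 A k x : (forall i, 0 <= x i) ->
  esym A k x = 0 -> esym A k.+1 x = 0.
Proof.
move=> x_ge0 e0; apply/eqP.
have: esym A k.+1 x *+ k.+1 == 0.
  rewrite esymS_sum big1 // => i iA; apply/eqP.
  case: k => [|k] in e0 *; first by move/eqP: e0; rewrite esym0 oner_eq0.
  move/eqP: e0; rewrite (esymS_setD1 _ _ iA) paddr_eq0 ?mulr_ge0 ?esym_ge0 //.
  by case/andP => /eqP-> _; rewrite mulr0.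
by rewrite mulrn_eq0.
Qed.

(** The value is 0 when the denominator vanishes; for non-negative [x] the numerator then vanishes
    too, so telescoping survives. *)
Definition esymq A k x : R := esym A k.+1 x / esym A k x.

Lemma esymq_ge0 A k x : (forall i, 0 <= x i) -> 0 <= esymq A k x.
Proof. by move=> x_ge0; rewrite divr_ge0 ?esym_ge0. Qed.

Lemma esym_prod_esymq A k x : (forall i, 0 <= x i) ->
  esym A k x = \prod_(i < k) esymq A i x.
Proof.
move=> x_ge0; elim: k => [|k IH]; first by rewrite big_ord0 esym0.
rewrite big_ord_recr -IH /= /esymq.
have [e0|e_neq0] := eqVneq (esym A k x) 0; last by rewrite mulrC divfK.
by rewrite e0 mul0r esymS_eq0.
Qed.

(** Half the harmonic mean, as for resistors in parallel; it is 0 when [a + b = 0]. *)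
Definition parallel (a b : R) : R := a * b / (a + b).

(** After multiplication by [a + b], the gap is the square of [s * a - (1 - s) * b]. *)
Lemma parallel_le (s a b : R) : 0 <= a -> 0 <= b ->
  parallel a b <= s ^+ 2 * a + (1 - s) ^+ 2 * b.
Proof.
move=> a_ge0 b_ge0; rewrite /parallel.
have [ab0|ab_neq0] := eqVneq (a + b) 0.
  by rewrite ab0 invr0 mulr0 addr_ge0 // mulr_ge0 ?sqr_ge0.
have ab_gt0 : 0 < a + b by rewrite lt0r ab_neq0 addr_ge0.
rewrite ler_pdivrMr // -subr_ge0.
rewrite (_ : _ - _ = (s * a - (1 - s) * b) ^+ 2) ?sqr_ge0 //; ring.
Qed.

(** For [a + b != 0], this [s] annuls the square that measures the gap in [parallel_le]. *)
Lemma parallel_eq (a b : R) : 0 <= a -> 0 <= b ->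
  let s := b / (a + b) in parallel a b = s ^+ 2 * a + (1 - s) ^+ 2 * b.
Proof.
move=> a_ge0 b_ge0 /=; rewrite /parallel.
have [/eqP|ab_neq0] := eqVneq (a + b) 0; last by field.
by rewrite paddr_eq0 // => /andP[/eqP-> /eqP->]; rewrite !(mul0r, mulr0, addr0).
Qed.

(* By [parallel_le] and [parallel_eq], [parallel] is a minimum of linear
   forms. *)
Lemma parallel_superlinear (t u a b c d e : R) :
    0 <= t -> 0 <= u -> 0 <= a -> 0 <= b -> 0 <= c -> 0 <= d ->
    t * b + u * d <= e ->
  t * parallel a b + u * parallel c d <= parallel (t * a + u * c) e.
Proof.
move=> t0 u0 a0 b0 c0 d0 e_ge.
have e0 : 0 <= e by rewrite (le_trans _ e_ge) // addr_ge0 ?mulr_ge0.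
(* The [s] that is optimal on the right bounds both terms on the left; the coefficient
   [(1 - s) ^+ 2] being non-negative gives monotonicity in [e]. *)
rewrite (@parallel_eq (_ + _) e) ?addr_ge0 ?mulr_ge0 //; set s := e / _.
have le1 := ler_wpM2l t0 (parallel_le s a0 b0).
have le2 := ler_wpM2l u0 (parallel_le s c0 d0).
have le3 := ler_wpM2l (sqr_ge0 (1 - s)) e_ge.
apply: le_trans (lerD le1 le2) _.
rewrite -subr_ge0; rewrite -subr_ge0 in le3.
by apply: le_trans le3 _; rewrite le_eqVlt; apply/orP; left; apply/eqP; ring.
Qed.

(** Divide [esymS_sum] by [esym A k.+1 x], expanded at [i] by [esymS_setD1]; then divide the
    numerator and denominator of each summand by [esym (A :\ i) k x]. *)
Lemma esymq_parallel A k x : (forall i, 0 <= x i) ->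
  esymq A k.+1 x =
    (\sum_(i in A) parallel (x i) (esymq (A :\ i) k x)) / k.+2%:R.
Proof.
move=> x_ge0; apply: canRL (mulfK _) _; first by rewrite pnatr_eq0.
rewrite mulrAC mulr_natr esymS_sum mulr_suml; apply: eq_bigr => i iA.
rewrite (esymS_setD1 _ _ iA) /parallel /esymq.
have := esymS_eq0 (A := A :\ i) (k := k) x_ge0.
have := esym_ge0 (A :\ i) k x_ge0; have := esym_ge0 (A :\ i) k.+1 x_ge0.
move: (esym _ k.+1 x) (esym _ k x) (x i) (x_ge0 i) => f e z z0 f0 e0.
(* In both degenerate cases, [e = 0] and [f + z * e = 0], also [f = 0], so both sides are 0. *)
have [->|e_neq0 _] := eqVneq e 0.
  by move=> ->; rewrite // !(mulr0, mul0r).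
have [/eqP|fez_neq0] := eqVneq (f + z * e) 0.
  rewrite paddr_eq0 ?mulr_ge0 // => /andP[/eqP-> _].
  by rewrite !(mulr0, mul0r).
by field; rewrite e_neq0 addrC.
Qed.

(** The case [k = 0] is linear. The induction is uniform in [A], since [esymq_parallel] passes to
    the sets [A :\ i]. *)
Lemma esymq_superlinear A k (t u : R) x y :
    0 <= t -> 0 <= u -> (forall i, 0 <= x i) -> (forall i, 0 <= y i) ->
  t * esymq A k x + u * esymq A k y <= esymq A k (fun i => t * x i + u * y i).
Proof.
move=> t0 u0 x0 y0; elim: k A => [|k IH] A.
  have E z : esymq A 0 z = \sum_(i in A) z i.
    rewrite /esymq esym0 divr1 -[LHS]mulr1n esymS_sum.
    by apply: eq_bigr => i _; rewrite esym0 mulr1.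
  by rewrite !E !mulr_sumr -big_split.
rewrite !esymq_parallel // => [|i]; last by rewrite addr_ge0 ?mulr_ge0.
rewrite !mulrA -mulrDl ler_wpM2r ?invr_ge0 ?ler0n //.
rewrite !mulr_sumr -big_split; apply: ler_sum => i _.
by apply: parallel_superlinear => //; apply: esymq_ge0.
Qed.

End QuotientConcavity.

(** * Superlinearity of the geometric mean *)

Section GeometricMean.
Variables (R : realType) (p : nat).
Hypothesis p_gt0 : (0 < p)%N.
Implicit Types b c g : 'I_p -> R.

Lemma root_exprn (z : R) : 0 <= z -> (z ^+ p) `^ p%:R^-1 = z.
Proof.
move=> z0; rewrite -powR_mulrn // -powRrM mulfV ?powRr1 //.
by rewrite pnatr_eq0 -lt0n.
Qed.

Lemma root_prod_le b : (forall i, 0 <= b i) ->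
  (\prod_i b i) `^ p%:R^-1 <= (\sum_i b i) / p%:R.
Proof.
move=> b0; have s0 : 0 <= (\sum_i b i) / p%:R.
  by rewrite divr_ge0 ?sumr_ge0.
(* [leif_AGM] bounds the product by the [p]-th power of the mean, so the mean is written as the root
   of its power. *)
rewrite -[leRHS]root_exprn //; apply: ge0_ler_powR; rewrite ?invr_ge0 //.
- by rewrite nnegrE prodr_ge0.
- by rewrite nnegrE exprn_ge0.
have [+ _] := leif_AGM (A := 'I_p) (E := b) (fun i _ => b0 i).
by rewrite card_ord.
Qed.

(** With the weights absorbed into the factors, AM-GM applies to the ratios [t * b i / g i] and to
    [u * c i / g i]; the two means add up to at most 1. *)
Lemma root_prod_superlinear (t u : R) b c g :
    0 <= t -> 0 <= u -> (forall i, 0 <= b i) -> (forall i, 0 <= c i) ->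
    (forall i, t * b i + u * c i <= g i) ->
  t * (\prod_i b i) `^ p%:R^-1 + u * (\prod_i c i) `^ p%:R^-1 <=
  (\prod_i g i) `^ p%:R^-1.
Proof.
move=> t0 u0 b0 c0 bcg.
have tb0 i : 0 <= t * b i by rewrite mulr_ge0.
have uc0 i : 0 <= u * c i by rewrite mulr_ge0.
have g0 i : 0 <= g i by rewrite (le_trans _ (bcg i)) ?addr_ge0.
have scale (s : R) (d : 'I_p -> R) : 0 <= s -> (forall i, 0 <= d i) ->
    s * (\prod_i d i) `^ p%:R^-1 = (\prod_i (s * d i)) `^ p%:R^-1.
  move=> s0 d0; rewrite big_split prodr_const card_ord.
  by rewrite powRM ?exprn_ge0 ?prodr_ge0 // root_exprn.
rewrite !scale //.
(* A vanishing [g i] forbids the ratios, but forces the [i]-th factor of both products on the left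
   to vanish. *)
have [[i gi0]|g_neq0] := pselect (exists i, g i = 0).
  have zero (d : 'I_p -> R) : d i = 0 -> (\prod_i d i) `^ p%:R^-1 = 0.
    move=> di0; rewrite (bigD1 i) //= di0 mul0r powR0 //.
    by rewrite invr_eq0 pnatr_eq0 -lt0n.
  have /andP[/eqP tb /eqP uc] : (t * b i == 0) && (u * c i == 0).
    by rewrite -paddr_eq0 // eq_le addr_ge0 // -[in X in _ <= X]gi0 bcg.
  by rewrite !zero // addr0.
have g_gt0 i : 0 < g i.
  by rewrite lt0r g0 andbT; apply/eqP => gi0; apply: g_neq0; exists i.
have factor (d : 'I_p -> R) : (forall i, 0 <= d i) ->
    (\prod_i d i) `^ p%:R^-1 <=
    (\prod_i g i) `^ p%:R^-1 * ((\sum_i (d i / g i)) / p%:R).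
  move=> d0; have dg0 i : 0 <= d i / g i by rewrite divr_ge0.
  have -> : \prod_i d i = (\prod_i g i) * \prod_i (d i / g i).
    rewrite -big_split; apply: eq_bigr => i _.
    by rewrite /= mulrC divfK ?gt_eqF.
  by rewrite powRM ?prodr_ge0 // ler_wpM2l ?powR_ge0 ?root_prod_le.
apply: le_trans (lerD (factor _ tb0) (factor _ uc0)) _.
rewrite -mulrDr ler_piMr ?powR_ge0 // -mulrDl -big_split /=.
rewrite ler_pdivrMr ?ltr0n // mul1r -[in leRHS](card_ord p) -sum1_card natr_sum.
apply: ler_sum => i _; rewrite -mulrDl ler_pdivrMr // mul1r; exact: bcg.
Qed.

End GeometricMean.

Lemma root_esym_superlinear (R : realType) (I : finType) (A : {set I})
    (d p : nat) (t u : R) (x y : I -> R) :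
    (0 < p)%N -> (d <= p)%N -> 0 <= t -> 0 <= u -> t + u = 1 ->
    (forall i, 0 <= x i) -> (forall i, 0 <= y i) ->
  t * (esym A d x) `^ p%:R^-1 + u * (esym A d y) `^ p%:R^-1 <=
  (esym A d (fun i => t * x i + u * y i)) `^ p%:R^-1.
Proof.
move=> p_gt0 dp t0 u0 tu1 x0 y0.
have z0 i : 0 <= t * x i + u * y i by rewrite addr_ge0 ?mulr_ge0.
(* Padding with p - d factors 1 also covers d < p, that is, a_p = 0. *)
pose q (z : I -> R) (i : 'I_p) := if (i < d)%N then esymq A i z else 1.
have q0 z i : (forall i, 0 <= z i) -> 0 <= q z i.
  by move=> ?; rewrite /q; case: ifP => // _; apply: esymq_ge0.
have E z : (forall i, 0 <= z i) -> esym A d z = \prod_i q z i.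
  move=> z_ge0; rewrite -big_mkcond esym_prod_esymq //=.
  by rewrite (big_ord_widen _ (fun i => esymq A i z) dp).
rewrite !E //; apply: root_prod_superlinear => // i; [exact: q0|exact: q0|].
rewrite /q; case: ifP => _; first exact: esymq_superlinear.
by rewrite !mulr1 tu1.
Qed.

(** * Real-rooted polynomials and their coefficients *)

Lemma real_rooted_factor (R : rcfType) (N : nat) (F : {poly R}) :
    (forall k, 0 <= F`_k) -> size F = N.+1 -> real_rooted F ->
  exists2 lambda : 'rV[R]_N, forall i, 0 <= lambda ord0 i &
    F = lead_coef F *: \prod_(i < N) ('X + (lambda ord0 i)%:P).
Proof.
move=> F_ge0 sF rrF; set iota := real_complex R.
have [r rE] := closed_field_poly_normal (map_poly iota F).
have F0 : F != 0 by rewrite -size_poly_eq0 sF.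
have l0 : lead_coef (map_poly iota F) != 0.
  by rewrite lead_coef_map fmorph_eq0 lead_coef_eq0.
have sr : size r = N.
  by apply/succn_inj; rewrite -sF -(size_map_poly iota) rE size_scale //
    size_prod_XsubC.
have rP z : z \in r -> z = iota (complex.Re z).
  move=> zr; suff /((real_rootedE F).1 rrF) : root (map_poly iota F) z.
    by case: z zr => a b /= _ ->.
  by rewrite rE rootZ // root_prod_XsubC.
pose s i : R := complex.Re r`_i.
(* As all roots are real, the complex factorization descends along the injective [iota]. *)
have FE : F = lead_coef F *: \prod_(i < N) ('X - (s i)%:P).
  apply: (map_poly_inj iota); rewrite linearZ /= rmorph_prod /= {1}rE.
  rewrite lead_coef_map (big_nth 0) big_mkord sr; congr (_ *: _).
  apply: eq_bigr => i _; rewrite rmorphB /= map_polyX map_polyC /=.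
  by congr (_ - _%:P); apply: rP; rewrite mem_nth ?sr.
have s_le0 (i : 'I_N) : s i <= 0.
  rewrite leNgt; apply/negP => si_gt0.
  have : F.[s i] = 0.
    rewrite FE hornerZ horner_prod (bigD1 i) //= hornerXsubC subrr.
    by rewrite mul0r mulr0.
  (* At a positive point the top term is positive and the others are non-negative. *)
  apply/eqP; rewrite gt_eqF // horner_coef sF big_ord_recr /=.
  apply: ltr_wpDl.
    by apply: sumr_ge0 => j _; rewrite mulr_ge0 ?exprn_ge0 ?(ltW si_gt0).
  rewrite mulr_gt0 ?exprn_gt0 // lt0r F_ge0 andbT.
  by have := F0; rewrite -lead_coef_eq0 /lead_coef sF.
exists (\row_i - s i) => [i|]; first by rewrite mxE oppr_ge0.
by rewrite {1}FE; congr (_ *: _); apply: eq_bigr => i _; rewrite mxE polyCN.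
Qed.

Lemma real_rooted_prod_XaddC (R : rcfType) (N : nat) (c : R)
    (lambda : 'rV[R]_N) : c != 0 ->
  real_rooted (c *: \prod_(i < N) ('X + (lambda ord0 i)%:P)).
Proof.
move=> c0; apply/real_rootedE => z.
rewrite linearZ /= rmorph_prod rootZ ?fmorph_eq0 //= /root horner_prod.
move/prodf_eq0 => [i _]; rewrite rmorphD /= map_polyX map_polyC /= !hornerE.
by rewrite addr_eq0 => /eqP->; rewrite /= oppr0.
Qed.

Lemma sumZXn_poly (R : nzRingType) p (a : 'I_p.+1 -> R) :
  \sum_(k < p.+1) a k *: 'X^k = \poly_(k < p.+1) a (inord k).
Proof. by rewrite poly_def; apply: eq_bigr => k _; rewrite inord_val. Qed.

(** As [Q] has degree below [m], the coefficient of [P] at [k] is that of the sum at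
    [m + k = (m + d) - (d - k)], which Vieta's formulas give. *)
Lemma real_rooted_coef_sigma (R : rcfType) (m d : nat) (P Q : {poly R}) :
    (forall k, 0 <= P`_k) -> (forall k, 0 <= Q`_k) ->
    size P = d.+1 -> (size Q <= m)%N -> real_rooted ('X^m * P + Q) ->
  exists2 lambda : 'rV[R]_(m + d), forall i, 0 <= lambda ord0 i &
    forall k, (k <= d)%N -> P`_k = lead_coef P * sigma (d - k) lambda.
Proof.
move=> P_ge0 Q_ge0 sP sQ rr; set F := _ + Q in rr.
have P0 : P != 0 by rewrite -size_poly_eq0 sP.
have sXP : size ('X^m * P) = (m + d).+1.
  by rewrite mulrC size_mulXn // sP addnS.
have ltQ : (size Q < size ('X^m * P)%R)%N.
  by rewrite sXP ltnS (leq_trans sQ) ?leq_addr.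
have sF : size F = (m + d).+1 by rewrite size_polyDl.
have lF : lead_coef F = lead_coef P.
  by rewrite lead_coefDl // lead_coefM lead_coefXn mul1r.
have F_ge0 k : 0 <= F`_k.
  by rewrite coefD coefXnM addr_ge0 //; case: ifP.
have [lambda l_ge0 FE] := real_rooted_factor F_ge0 sF rr.
exists lambda => // k kd.
have -> : P`_k = F`_(m + k).
  rewrite coefD coefXnM ltnNge leq_addr addKn /=.
  rewrite (nth_default _ (s := Q)) ?addr0 //.
  by rewrite (leq_trans sQ) ?leq_addr.
rewrite FE coefZ lF -coef_prod_XaddC; last first.
  by rewrite (leq_trans (leq_subr _ _)) ?leq_addl.
by rewrite -addnBA ?leq_subr ?subKn.
Qed.

Lemma sigma_real_rooted (R : rcfType) (m p : nat) (c : R) (P : {poly R})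
    (lambda : 'rV[R]_(m + p)) :
    0 < c -> (forall i, 0 <= lambda ord0 i) -> (size P <= p.+1)%N ->
    (forall k, (k <= p)%N -> P`_k = c * sigma (p - k) lambda) ->
  exists2 Q : {poly R}, (forall k, 0 <= Q`_k) /\ (size Q <= m)%N &
    real_rooted ('X^m * P + Q).
Proof.
move=> c_gt0 l_ge0 sP PE.
set F := c *: \prod_(i < m + p) ('X + (lambda ord0 i)%:P).
have sF : size F = (m + p).+1.
  rewrite size_scale ?gt_eqF // (eq_bigr (fun i => 'X - (- lambda ord0 i)%:P)).
    by rewrite size_prod_XsubC /index_enum -enumT size_enum_ord.
  by move=> i _; rewrite polyCN opprK.
have FE k : (k <= m + p)%N -> F`_k = c * sigma (m + p - k) lambda.
  by move=> kmp; rewrite coefZ -coef_prod_XaddC ?leq_subr // subKn.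
(* The coefficients of [F] from degree [m] on are those of [P]; the lower ones form the witness, and
   are [c] times values of [sigma] at [lambda]. *)
exists (take_poly m F).
  split=> [k|]; last exact: size_take_poly.
  rewrite coef_take_poly; case: ifP => // km.
  rewrite FE; last by rewrite (leq_trans (ltnW km)) ?leq_addr.
  by rewrite mulr_ge0 ?(ltW c_gt0) // sigma_esym esym_ge0.
suff -> : P = drop_poly m F.
  rewrite mulrC addrC poly_take_drop; apply: real_rooted_prod_XaddC.
  by rewrite gt_eqF.
apply/polyP => k; rewrite coef_drop_poly addnC; have [kp|pk] := leqP k p.
  by rewrite PE // FE ?leq_add2l // subnDl.
rewrite !nth_default ?sF ?ltn_add2l //; exact: leq_trans sP pk.
Qed.

(** * Concavity for the concatenated vector, and conclusion *)

Lemma concave_root_sigma (R : realType) (n m d p : nat) (c t : R)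
    (lambda : 'rV[R]_(m + d)) (x y : 'rV[R]_n) :
    let g (v : 'rV[R]_n) : R :=
      c * \sum_(k < d.+1) sigma (d - k) lambda * sigma k v in
    (0 < p)%N -> (d <= p)%N -> 0 <= c -> (forall i, 0 <= lambda ord0 i) ->
    0 <= t <= 1 -> (forall i, 0 < x ord0 i) -> (forall i, 0 < y ord0 i) ->
  t * g x `^ p%:R^-1 + (1 - t) * g y `^ p%:R^-1 <=
  g (t *: x + (1 - t) *: y) `^ p%:R^-1.
Proof.
move=> g p_gt0 dp c0 l0 /andP[t0 t1] x0 y0; rewrite /g.
pose z (v : 'rV[R]_n) (i : 'I_(m + d) + 'I_n) :=
  match i with inl i => lambda ord0 i | inr j => v ord0 j end.
have E v : \sum_(k < d.+1) sigma (d - k) lambda * sigma k v =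
    esym [set: 'I_(m + d) + 'I_n] d (z v).
  by rewrite esym_sum; apply: eq_bigr => k _; rewrite !sigma_esym.
have z0 (v : 'rV[R]_n) : (forall i, 0 < v ord0 i) -> forall i, 0 <= z v i.
  by move=> v0 [i|j] //=; rewrite ltW.
have u0 : 0 <= 1 - t by rewrite subr_ge0.
(* The [lambda] part is constant in [v], hence preserved by convex combinations. *)
have zE : z (t *: x + (1 - t) *: y) = (fun i => t * z x i + (1 - t) * z y i).
  apply/funext => -[i|j] /=; last by rewrite !mxE.
  by rewrite -mulrDl addrC subrK mul1r.
have w0 i : 0 <= z (t *: x + (1 - t) *: y) i.
  by rewrite zE addr_ge0 ?mulr_ge0 ?z0.
rewrite !E !powRM ?esym_ge0 //; [|exact: z0|exact: z0].
rewrite ![_ * (c `^ _ * _)]mulrCA -mulrDr ler_wpM2l ?powR_ge0 // zE.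
apply: root_esym_superlinear => //; [|exact: z0|exact: z0].
by rewrite addrC subrK.
Qed.

Theorem theorem3p8 (R : realType) (n p : nat) (n_gt0 : (0 < n)%N)
    (p_gt0 : (0 < p)%N) (a : 'I_p.+1 -> R) (a_ge0 : forall k, 0 <= a k) :
  let P : {poly R} := \sum_(k < p.+1) a k *: 'X^k in
  let f (x : 'rV[R]_n) : R := \sum_(k < p.+1) a k * sigma k x in
  let f_root_concave : Prop :=
    concave_function [set x : 'rV[R]_n | forall i, 0 < x ord0 i]
      (fun x => f x `^ (p%:R)^-1) in
  let polynomial_condition : Prop :=
    exists (m : nat) (Q : {poly R}),
      [/\ (forall k, 0 <= Q`_k), (size Q <= m)%N
        & real_rooted ('X^m * P + Q)] in
  let sigma_condition : Prop :=
    exists (m : nat) (lambda : 'rV[R]_(m + p)),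
      (forall i, 0 <= lambda ord0 i) /\
      (forall k : 'I_p.+1, a k / a ord_max = sigma (p - k) lambda) in
  [/\ polynomial_condition -> f_root_concave,
      0 < a ord_max -> sigma_condition -> f_root_concave
    & 0 < a ord_max -> (polynomial_condition <-> sigma_condition)].
Proof.
move=> P f f_root_concave polynomial_condition sigma_condition.
have PE : P = \poly_(k < p.+1) a (inord k) by exact: sumZXn_poly.
have sP : (size P <= p.+1)%N by rewrite PE size_poly.
have Pa (k : 'I_p.+1) : P`_k = a k by rewrite PE coef_poly ltn_ord inord_val.
have P_ge0 k : 0 <= P`_k by rewrite PE coef_poly; case: ifP.
(* The bound [d] is left free: it will be [p] when [P = 0] and the exact degree of [P] otherwise. *)
have fE x d : (size P <= d.+1)%N -> (d <= p)%N ->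
    f x = \sum_(k < d.+1) P`_k * sigma k x.
  move=> sPd dp.
  rewrite (@big_ord_widen _ _ _ d.+1 p.+1 (fun k => P`_k * sigma k x) dp).
  rewrite big_mkcond /=; apply: eq_bigr => k _; rewrite -Pa.
  by case: ltnP => // dk; rewrite nth_default ?mul0r // (leq_trans sPd).
have concave : polynomial_condition -> f_root_concave.
  move=> [m [Q [Q_ge0 sQ rr]]].
  (* The zero polynomial has no degree to use; then [f] is 0, and so is its root, the exponent being
     nonzero. *)
  have [P0|P0] := eqVneq P 0.
    apply/concave_functionE => t x y _ _ _.
    have f0 v : f v = 0.
      by rewrite (fE v p) // big1 // => k _; rewrite P0 coef0 mul0r.
    have p_neq0 : (p%:R : R)^-1 != 0 by rewrite invr_eq0 pnatr_eq0 -lt0n.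
    by rewrite !f0 powR0 // !mulr0 addr0.
  have [d sPd] : exists d, size P = d.+1.
    by exists (size P).-1; rewrite prednK // lt0n size_poly_eq0.
  have dp : (d <= p)%N by rewrite -ltnS -sPd.
  have [lambda l_ge0 Pl] := real_rooted_coef_sigma P_ge0 Q_ge0 sPd sQ rr.
  have fl x : f x =
      lead_coef P * \sum_(k < d.+1) sigma (d - k) lambda * sigma k x.
    rewrite (fE x d) ?sPd // mulr_sumr; apply: eq_bigr => k _.
    by rewrite Pl ?leq_ord // mulrA.
  apply/concave_functionE => t x y t01 x0 y0; rewrite !fl.
  by apply: concave_root_sigma => //; apply: P_ge0.
have equiv : 0 < a ord_max -> (polynomial_condition <-> sigma_condition).
  move=> ap_gt0; have sPp : size P = p.+1.
    apply/eqP; rewrite eqn_leq sP ltnNge; apply/negP => sPp.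
    by move: ap_gt0; rewrite -Pa nth_default ?ltxx.
  have lP : lead_coef P = a ord_max by rewrite /lead_coef sPp -Pa.
  split=> [[m [Q [Q_ge0 sQ rr]]]|[m [lambda [l_ge0 al]]]].
    have [lambda l_ge0 Pl] := real_rooted_coef_sigma P_ge0 Q_ge0 sPp sQ rr.
    exists m, lambda; split=> // k.
    by rewrite -Pa Pl ?leq_ord // lP mulrC mulKf // gt_eqF.
  have Pl k : (k <= p)%N -> P`_k = a ord_max * sigma (p - k) lambda.
    rewrite -ltnS => kp; rewrite (Pa (Ordinal kp)) -(al (Ordinal kp)).
    by rewrite mulrC divfK // gt_eqF.
  have [Q [Q_ge0 sQ] rr] := sigma_real_rooted ap_gt0 l_ge0 sP Pl.
  by exists m, Q.
by split=> // ap_gt0 /(equiv ap_gt0).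
Qed.
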